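(* For every integer $n\geq 2$, Kemeny's constant of the pentagonal cylinder chain $P_n$ and of the pentagonal Möbius chain $P'_n$ are \[ \operatorname{Kc}(P_n)=\frac{49n^2+42n-19}{42}+ \frac{\frac{7\sqrt{6}n}{8}\left[\left(\sqrt{3}+\sqrt{2}\right)^{2n}-\left(\sqrt{3}-\sqrt{2}\right)^{2n}\right]}{(\sqrt{3}+\sqrt{2})^{2n}+(\sqrt{3}-\sqrt{2})^{2n}-2}, \] \[ \operatorname{Kc}(P'_n)=\frac{49n^2+42n-19}{42}+ \frac{\frac{7\sqrt{6}n}{8}\left[\left(\sqrt{3}+\sqrt{2}\right)^{2n}-\left(\sqrt{3}-\sqrt{2}\right)^{2n}\right]}{(\sqrt{3}+\sqrt{2})^{2n}+(\sqrt{3}-\sqrt{2})^{2n}+2}. \]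
   Context: For $n\geq 2$, both graphs have vertex set $\{u_1,\dots,u_{2n}\}\cup\{u'_1,\dots,u'_{2n}\}\cup\{w_1,\dots,w_n\}$. Common edges: $u_ku_{k+1}$ and $u'_ku'_{k+1}$ for $1\le k\le 2n-1$; $u_{2k-1}u'_{2k-1}$ for $1\le k\le n$; $u_{2k}w_k$ and $w_ku'_{2k}$ for $1\le k\le n$. The pentagonal cylinder chain $P_n$ additionally has edges $u_{2n}u_1$ and $u'_{2n}u'_1$; the pentagonal Möbius chain $P'_n$ instead has edges $u_{2n}u'_1$ and $u'_{2n}u_1$. For a connected simple graph $G$ with degrees $d_i$, the normalized Laplacian $\mathcal{L}(G)$ has diagonal entries $1$, entries $-1/\sqrt{d_id_j}$ for adjacent $v_i,v_j$, and $0$ otherwise; with its eigenvalues $0=\lambda_1<\lambda_2\le\cdots\le\lambda_{|V|}$, Kemeny's constant is $\operatorname{Kc}(G)=\sum_{i=2}^{|V|}1/\lambda_i$. *)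

(* Defs.v *)
From HB Require Import structures.
From mathcomp Require Import all_boot all_order all_algebra.
From mathcomp Require Import polyrcf.

Set Implicit Arguments.
Unset Strict Implicit.
Unset Printing Implicit Defensive.

Import Order.TTheory GRing.Theory Num.Theory.

Record sgraph := SGraph {
  vertex :> finType;
  adj : rel vertex;
  adj_sym : symmetric adj;
  adj_irr : irreflexive adj }.

Definition degree (G : sgraph) (x : G) : nat := #|[set y | adj x y]|.

Definition connected_graph (G : sgraph) : Prop :=
  forall x y : G, connect (@adj G) x y.

Section Kemeny.
Local Open Scope ring_scope.
Variable R : rcfType.

(* Rows and columns are indexed by the enumeration of the vertices. *)
Definition normalized_laplacian (G : sgraph) : 'M[R]_#|G| :=
  \matrix_(i, j)
    let x := enum_val i in
    let y := enum_val j in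
    if i == j then 1
    else if adj x y then - (Num.sqrt (degree x * degree y)%:R)^-1
    else 0.

(* The eigenvalues of M lying in R, in nondecreasing order, each repeated
   according to its algebraic multiplicity (rootsR is increasing and
   duplicate-free).  For a symmetric M these are all the n eigenvalues. *)
Definition eigenvalues n (M : 'M[R]_n) : seq R :=
  flatten [seq nseq (mup x (char_poly M)) x | x <- rootsR (char_poly M)].

(* Indices start at 0, so only the smallest eigenvalue is left out; it is the
   simple eigenvalue 0 when G is connected. *)
Definition kemeny (G : sgraph) : R :=
  \sum_(1 <= i < #|G|) ((eigenvalues (normalized_laplacian G))`_i)^-1.

End Kemeny.

(* inl (inl i), inl (inr i) and inr k stand for u_{i+1}, u'_{i+1} and w_{k+1}:
   all indices are shifted by one. *)
Definition pent_vertex (n : nat) : finType :=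
  ('I_(2 * n) + 'I_(2 * n) + 'I_n)%type.

(* One orientation of each edge common to both chains. *)
Definition pent_edge n (x y : pent_vertex n) : bool :=
  match x, y with
  | inl (inl i), inl (inl j) => j == i.+1 :> nat
  | inl (inr i), inl (inr j) => j == i.+1 :> nat
  | inl (inl i), inl (inr j) => (i == j) && ~~ odd i
  | inl (inl i), inr k => i == (2 * k).+1 :> nat
  | inr k, inl (inr j) => j == (2 * k).+1 :> nat
  | _, _ => false
  end.

Definition cylinder_edge n (x y : pent_vertex n) : bool :=
  match x, y with
  | inl (inl i), inl (inl j) => (i.+1 == 2 * n) && (j == 0 :> nat)
  | inl (inr i), inl (inr j) => (i.+1 == 2 * n) && (j == 0 :> nat)
  | _, _ => false
  end.

Definition moebius_edge n (x y : pent_vertex n) : bool :=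
  match x, y with
  | inl (inl i), inl (inr j) => (i.+1 == 2 * n) && (j == 0 :> nat)
  | inl (inr i), inl (inl j) => (i.+1 == 2 * n) && (j == 0 :> nat)
  | _, _ => false
  end.

Definition chain_adj n (closing : rel (pent_vertex n)) : rel (pent_vertex n) :=
  fun x y => [|| pent_edge x y, pent_edge y x, closing x y | closing y x].

Lemma chain_adj_sym n (closing : rel (pent_vertex n)) :
  symmetric (chain_adj closing).
Proof.
move=> x y; rewrite /chain_adj.
by case: (pent_edge x y); case: (pent_edge y x); rewrite //= orbC.
Qed.

Lemma pent_edge_irr n : irreflexive (@pent_edge n).
Proof. by move=> [[i|i]|k] //=; rewrite ltn_eqF. Qed.

Lemma cylinder_adj_irr n : irreflexive (chain_adj (@cylinder_edge n)).
Proof.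
move=> x; rewrite /chain_adj pent_edge_irr orbb /=.
by case: x => [[i|i]|k] //=; case: i => -[|i] hi //=;
  rewrite ?andbF // andbT; case: n hi => [|n] //; rewrite mulnS.
Qed.

Lemma moebius_adj_irr n : irreflexive (chain_adj (@moebius_edge n)).
Proof. by move=> [[i|i]|k]; rewrite /chain_adj pent_edge_irr. Qed.

Definition pentagonal_cylinder_chain (n : nat) : sgraph :=
  SGraph (chain_adj_sym (@cylinder_edge n)) (@cylinder_adj_irr n).

Definition pentagonal_moebius_chain (n : nat) : sgraph :=
  SGraph (chain_adj_sym (@moebius_edge n)) (@moebius_adj_irr n).

Lemma chain_connected n (closing : rel (pent_vertex n)) (x y : pent_vertex n) :
  connect (chain_adj closing) x y.
Proof.
have sym : connect_sym (chain_adj closing).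
  by apply: sym_connect_sym; exact: chain_adj_sym.
have n_gt0 : 0 < 2 * n.
  by case: x => [[[i hi]|[i hi]]|[k hk]]; rewrite ?(leq_ltn_trans _ hi) //
    muln_gt0 (leq_ltn_trans _ hk).
pose o := Ordinal n_gt0; pose r : pent_vertex n := inl (inl o).
have edge a b : pent_edge a b -> connect (chain_adj closing) a b.
  by move=> h; apply: connect1; rewrite /chain_adj h.
have hu (i : 'I_(2 * n)) : connect (chain_adj closing) r (inl (inl i)).
  case: i => i; elim: i => [|i IH] hi.
    by rewrite (_ : Ordinal hi = o) //; apply: val_inj.
  by apply: connect_trans (IH (ltnW hi)) (edge _ _ _) => /=.
have hv (i : 'I_(2 * n)) : connect (chain_adj closing) r (inl (inr i)).
  case: i => i; elim: i => [|i IH] hi.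
    rewrite (_ : Ordinal hi = o); last exact: val_inj.
    by exact: edge.
  by apply: connect_trans (IH (ltnW hi)) (edge _ _ _) => /=.
have h z : connect (chain_adj closing) r z.
  case: z => [[i|i]|k]; [exact: hu | exact: hv |].
  have hk : (2 * k).+1 < 2 * n.
    have := ltn_ord k; rewrite -(leq_pmul2l (isT : 0 < 2)); by rewrite mulnS.
  by apply: connect_trans (hu (Ordinal hk)) (edge _ _ _) => /=.
by rewrite (connect_trans _ (h y)) // sym.
Qed.

Lemma cylinder_connected n : connected_graph (pentagonal_cylinder_chain n).
Proof. by move=> x y; exact: chain_connected. Qed.

Lemma moebius_connected n : connected_graph (pentagonal_moebius_chain n).
Proof. by move=> x y; exact: chain_connected. Qed.

(* Main.v *)
Require Import Defs.
From mathcomp Require Import all_boot all_order all_algebra.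
From mathcomp Require Import polyrcf complex ring lra zify.
Local Open Scope ring_scope.

Set Implicit Arguments.
Unset Strict Implicit.
Unset Printing Implicit Defensive.

Import Order.TTheory GRing.Theory Num.Theory.

(** If [Z] is a Green kernel of the random walk on [G], i.e. each column
    satisfies [(I - P) Z(., y) = delta_y - pi_y], then the similarity of [I - P]
    with the normalized Laplacian gives [Kc(G) = sum_y (Z(y, y) - Z(x0, y))] for
    every vertex [x0].  For the chains such a kernel is explicit.  The swap
    [u_k <-> u'_k] splits functions into symmetric and antisymmetric ones.  On
    the symmetric part, eliminating the [w_k] leaves a cycle of length [2n]
    whose Green function is quadratic in the distance; this part is the same for
    both chains and gives the rational term.  On the antisymmetric part, which
    vanishes at the [w_k], one gets a cycle of length [2n] with potential,
    periodic for the cylinder and antiperiodic for the Moebius chain, whose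
    solutions are combinations of the powers of [sqrt 3 - sqrt 2] and
    [sqrt 3 + sqrt 2]. *)

(** * Sums of inverse eigenvalues *)

Lemma char_poly_conj (F : fieldType) n (P M : 'M[F]_n) : P \in unitmx ->
  char_poly (invmx P *m M *m P) = char_poly M.
Proof.
move=> Pu; rewrite /char_poly /char_poly_mx.
have Qu : map_mx polyC P \in unitmx by rewrite map_unitmx.
have -> : 'X%:M - map_mx polyC (invmx P *m M *m P) =
    invmx (map_mx polyC P) *m ('X%:M - map_mx polyC M) *m map_mx polyC P.
  rewrite mulmxBr mulmxBl scalar_mxC -(mulmxA 'X%:M) mulVmx // mulmx1.
  by rewrite !map_mxM map_invmx.
by rewrite !det_mulmx mulrC mulrA -det_mulmx mulmxV // det1 mul1r.
Qed.

Section Eigenvalues.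
Variables (R : rcfType) (n : nat) (M : 'M[R]_n) (s : seq R).
Hypothesis Ms : char_poly M = \prod_(x <- s) ('X - x%:P).

Let rootsE x : (x \in rootsR (char_poly M)) = (x \in s).
Proof.
have := roots_on_rootsR (monic_neq0 (char_poly_monic M)) x.
by rewrite in_itv /= => <-; rewrite Ms root_prod_XsubC.
Qed.

Lemma eigenvalues_perm : perm_eq (eigenvalues M) s.
Proof.
apply/allP => x _; apply/eqP; rewrite /= /eigenvalues.
rewrite count_flatten -map_comp sumnE big_map.
under eq_bigr => y _ do rewrite /= count_nseq Ms mu_prod_XsubC.
have uR : uniq (rootsR (char_poly M)) by exact: uniq_roots.
have [xs|xs] := boolP (x \in s).
  rewrite (bigD1_seq x) ?rootsE //= eqxx mul1n big1_seq ?addn0 // => y /andP[yx _].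
  by rewrite (negbTE yx).
rewrite (count_memPn xs) big1_seq // => y /andP[_]; rewrite rootsE => ys.
have yx : y != x by apply: contraNneq xs => <-.
by rewrite /= (negbTE yx).
Qed.

(** [kemeny] leaves out index 0, so the omitted entry has to be the eigenvalue 0. Since [rootsR] is
    increasing, the least root comes first. *)
Lemma eigenvalues_nth0 : 0 \in s -> {in s, forall x, 0 <= x} -> (eigenvalues M)`_0 = 0.
Proof.
move=> s0 s_ge0; rewrite /eigenvalues.
have: sorted <%R (rootsR (char_poly M)) by exact: sorted_roots.
have := rootsE; case: (rootsR _) => [|r rs] rE /=; first by rewrite -rE in s0.
move=> /(order_path_min lt_trans)/allP r_min.
have r0 : r = 0.
  apply/eqP; move: s0; rewrite -rE inE => /predU1P[->//|/r_min r_lt0].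
  by have := s_ge0 r; rewrite -rE mem_head leNgt r_lt0 => /(_ isT).
have: (0 < mup r (char_poly M))%N.
  by rewrite Ms mu_prod_XsubC -has_count has_pred1 -rE mem_head.
by case: (mup _ _) => //=.
Qed.
End Eigenvalues.

(** The first three equations make [W] the group inverse of [L], so [W *m L] is a projection fixing
    the image of [L]. It fixes [L *m Z] and kills [v^T], hence equals [1%:M - v^T *m v]. Evaluating
    [W *m L *m Z] in two ways then gives [W]. *)
Lemma group_inverse_green (F : fieldType) n (L W Z : 'M[F]_n) (v : 'rV[F]_n) :
  W *m L = L *m W -> L *m W *m L = L -> W *m L *m W = W ->
  L *m v^T = 0 -> L *m Z = 1%:M - v^T *m v -> W = (1%:M - v^T *m v) *m Z.
Proof.
move=> WL LWL WLW Lv LZ.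
have Wv : W *m v^T = 0 by rewrite -WLW -(mulmxA W L W) -WL -!mulmxA Lv !mulmx0.
have E : W *m L = 1%:M - v^T *m v.
  have : W *m L *m (L *m Z) = L *m Z by rewrite WL !mulmxA LWL.
  by rewrite LZ mulmxBr mulmx1 mulmxA -(mulmxA W) Lv mulmx0 mul0mx subr0.
by rewrite -E -mulmxA LZ mulmxBr mulmx1 mulmxA Wv mul0mx subr0.
Qed.

(** Over [R[i]] the matrix is Hermitian, hence normal with real spectrum. [Q] may stay complex: only
    the characteristic polynomial and a trace are brought back to [R]. *)
Lemma symmetric_spectral (R : rcfType) n (M : 'M[R]_n) : M^T = M ->
  exists (Q : 'M[R[i]%C]_n) (d : 'rV[R]_n), Q \in unitmx /\
    map_mx (real_complex R) M = invmx Q *m diag_mx (map_mx (real_complex R) d) *m Q.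
Proof.
move=> Msym; pose MC := map_mx (real_complex R) M.
have MCh : MC \is hermsymmx.
  apply: realsym_hermsym.
    by apply/is_hermitianmxP; rewrite expr0 scale1r map_mx_id // map_trmx Msym.
  by apply/mxOverP => i j; rewrite mxE; apply/complex_realP; exists (M i j).
have /orthomx_spectralP MCE := hermitian_normalmx MCh.
exists (spectralmx MC), (map_mx (@complex.Re R) (spectral_diag MC)).
split; first exact: spectral_unit.
suff -> : map_mx (real_complex R) (map_mx (@complex.Re R) (spectral_diag MC))
    = spectral_diag MC.
  exact: MCE.
apply/rowP => i; rewrite !mxE RRe_real //.
by move/mxOverP: (hermitian_spectral_diag_real MCh); apply.
Qed.

(** As [0^-1 = 0], the right-hand side is the trace of the Moore-Penrose inverse
    of [M], also when [0] is a multiple eigenvalue. *)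
Lemma sum_inv_eigenvalues (R : rcfType) n (M Z : 'M[R]_n) (v : 'rV[R]_n) :
  M^T = M -> (forall u : 'rV[R]_n, 0 <= (u *m M *m u^T) 0 0) ->
  v *m M = 0 -> v != 0 -> M *m Z = 1%:M - v^T *m v ->
  \sum_(1 <= i < n) ((eigenvalues M)`_i)^-1 = \tr ((1%:M - v^T *m v) *m Z).
Proof.
move=> Msym Mpsd vM v_neq0 MZ.
pose f : {rmorphism R -> R[i]%C} := real_complex R.
pose MC := map_mx f M.
have [Q [d [Qu]]] := symmetric_spectral Msym; rewrite -/MC -/f => MCE.
pose s := [seq d 0 i | i <- enum 'I_n].
have Ms : char_poly M = \prod_(x <- s) ('X - x%:P).
  apply: (@map_poly_inj _ _ f); rewrite map_char_poly -/MC MCE char_poly_conj //.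
  rewrite char_poly_trig ?diag_mx_is_trig // rmorph_prod big_map big_enum /=.
  by apply: eq_bigr => i _; rewrite rmorphB /= map_polyX map_polyC !mxE eqxx.
have s_ge0 : {in s, forall x, 0 <= x}.
  move=> x; rewrite -root_prod_XsubC -Ms -eigenvalue_root_char.
  move=> /eigenvalueP[u uM u_neq0]; have := Mpsd u.
  rewrite uM -scalemxAl mxE pmulr_lge0 //.
  have uu i : 0 <= u 0 i * u^T i 0 by rewrite [u^T _ _]mxE -expr2 sqr_ge0.
  rewrite mxE lt0r sumr_ge0 // andbT; apply: contra u_neq0.
  rewrite psumr_eq0 // => /allP u0; apply/eqP/rowP => i; rewrite !mxE.
  by have := u0 i (mem_index_enum i); rewrite /= [u^T _ _]mxE mulf_eq0 orbb => /eqP.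
have s0 : 0 \in s.
  rewrite -root_prod_XsubC -Ms -eigenvalue_root_char.
  by apply/eigenvalueP; exists v => //; rewrite vM scale0r.
have e0 := eigenvalues_nth0 Ms s0 s_ge0.
have es := eigenvalues_perm Ms.
have size_e : size (eigenvalues M) = n by rewrite (perm_size es) size_map size_enum_ord.
have n_gt0 : (0 < n)%N by rewrite -size_e (perm_size es); case: (s) s0.
(* The omitted eigenvalue 0 can be put back, as its inverse is 0. *)
transitivity (\sum_i (d 0 i)^-1).
  transitivity (\sum_(x <- s) x^-1); last by rewrite big_map big_enum.
  by rewrite -(perm_big _ es) [RHS](big_nth 0) size_e [RHS]big_ltn //= e0 invr0 add0r.
apply: complexI.
(* Inverting the diagonal entrywise, zeros included, yields the group inverse of [MC]. *)
pose W := invmx Q *m diag_mx (map_mx f (map_mx (@GRing.inv _) d)) *m Q.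
transitivity (\tr W).
  rewrite /W mxtrace_mulC mulmxA mulmxV // mul1mx mxtrace_diag.
  rewrite (eq_bigr (fun i => f (d 0 i)^-1)); first by rewrite -rmorph_sum.
  by move=> i _; rewrite !mxE.
transitivity (\tr (map_mx f ((1%:M - v^T *m v) *m Z))); last by rewrite trace_map_mx.
congr mxtrace; rewrite map_mxM map_mxB map_mx1 map_mxM -map_trmx.
have conjM (A B : 'M_n) : (invmx Q *m A *m Q) *m (invmx Q *m B *m Q) =
    invmx Q *m (A *m B) *m Q by rewrite !mulmxA mulmxK.
apply: (@group_inverse_green _ _ MC).
- rewrite MCE /W !conjM !mulmx_diag.
  by congr (invmx Q *m diag_mx _ *m Q); apply/rowP => i; rewrite !mxE mulrC.
- rewrite MCE /W !conjM !mulmx_diag.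
  congr (invmx Q *m diag_mx _ *m Q); apply/rowP => i; rewrite !mxE fmorphV.
  by have [->|?] := eqVneq (f (d 0 i)) 0; rewrite ?mul0r // divfK.
- rewrite MCE /W !conjM !mulmx_diag.
  congr (invmx Q *m diag_mx _ *m Q); apply/rowP => i; rewrite !mxE fmorphV.
  by have [->|?] := eqVneq (f (d 0 i)) 0; rewrite ?invr0 ?mul0r // mulVf ?mul1r.
- by rewrite map_trmx /MC -map_mxM -Msym -trmx_mul vM trmx0 map_mx0.
- by rewrite /MC -map_mxM MZ map_mxB map_mx1 map_mxM map_trmx.
Qed.

(** * Kemeny's constant from a Green kernel *)

Section Green.
Variables (R : rcfType) (G : sgraph).

(** Summation by parts: exchanging the ends of each edge turns the left side into a second copy of
    itself, and the two copies add up to the squares. *)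
Lemma dirichlet_form (f : G -> R) :
  \sum_x f x * (\sum_(z | adj x z) (f x - f z)) =
  2^-1 * \sum_x \sum_(z | adj x z) (f x - f z) ^+ 2.
Proof.
under eq_bigr => x _ do rewrite mulr_sumr.
set T := LHS; have T' : T = \sum_x \sum_(z | adj x z) f z * (f z - f x).
  rewrite /T (exchange_big_dep xpredT) //=; apply: eq_bigr => x _.
  by apply: eq_bigl => z; rewrite adj_sym.
have -> : \sum_x \sum_(z | adj x z) (f x - f z) ^+ 2 = T + T.
  rewrite {2}T' -big_split; apply: eq_bigr => x _; rewrite -big_split.
  by apply: eq_bigr => z _ /=; ring.
by field.
Qed.

Lemma dirichlet_form_ge0 (f : G -> R) :
  0 <= \sum_x f x * (\sum_(z | adj x z) (f x - f z)).
Proof.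
rewrite dirichlet_form mulr_ge0 ?invr_ge0 //.
by apply: sumr_ge0 => x _; apply: sumr_ge0 => z _; exact: sqr_ge0.
Qed.

(** The Dirichlet form of a harmonic function is zero, so [f] agrees across each edge and hence
    along paths. *)
Lemma harmonic_constant (f : G -> R) : connected_graph G ->
  (forall x, \sum_(z | adj x z) (f x - f z) = 0) -> forall x y, f x = f y.
Proof.
move=> Gconn f_harm x y.
have /eqP : 2^-1 * \sum_x \sum_(z | adj x z) (f x - f z) ^+ 2 = 0.
  by rewrite -dirichlet_form big1 // => z _; rewrite f_harm mulr0.
have sq_ge0 (z : G) : 0 <= \sum_(t | adj z t) (f z - f t) ^+ 2.
  by apply: sumr_ge0 => t _; exact: sqr_ge0.
rewrite mulf_eq0 invr_eq0 pnatr_eq0 /= psumr_eq0 // => /allP sq0.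
have f_edge z t : adj z t -> f z = f t.
  move=> zt; have /= := sq0 z (mem_index_enum z).
  rewrite psumr_eq0; last by move=> *; exact: sqr_ge0.
  move/allP/(_ t (mem_index_enum t)); rewrite zt /= sqrf_eq0 subr_eq0.
  by move/eqP.
have /connectP[p] := Gconn x y.
elim: p x => [|z p IHp] x /= => [_ -> //|/andP[xz zp] yE].
by rewrite (f_edge _ _ xz); exact: IHp.
Qed.

Lemma sum_enum_val (F : G -> R) : \sum_(i < #|G|) F (enum_val i) = \sum_x F x.
Proof. by rewrite [RHS](reindex _ (onW_bij _ (@enum_val_bij G))). Qed.

Hypothesis deg_gt0 : forall x : G, (0 < degree x)%N.

Let q (x : G) : R := Num.sqrt (degree x)%:R.
Let q_neq0 x : q x != 0. Proof. by rewrite sqrtr_eq0 -ltNge ltr0n deg_gt0. Qed.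
Let q_sqr x : q x * q x = (degree x)%:R. Proof. by rewrite -expr2 sqr_sqrtr ?ler0n. Qed.

(** With [D] the degree matrix and [A] the adjacency matrix, this is [L D^(1/2) = D^(-1/2) (D - A)]
    applied to [g]. *)
Lemma normalized_laplacian_sum (g : G -> R) i :
  \sum_j normalized_laplacian R G i j * (q (enum_val j) * g (enum_val j)) =
  (q (enum_val i))^-1 *
    \sum_(z | adj (enum_val i) z) (g (enum_val i) - g z).
Proof.
set x := enum_val i.
rewrite sumrB mulrBr sumr_const.
have -> : #|[pred z | adj x z]| = degree x by rewrite /degree cardsE.
rewrite -[g x *+ _]mulr_natl -q_sqr -mulrA mulKf //.
rewrite (eq_bigr (fun j => (x == enum_val j)%:R * (q (enum_val j) * g (enum_val j))
   - (adj x (enum_val j))%:R * ((q x)^-1 * g (enum_val j)))); last first.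
  move=> j _; rewrite mxE /= -/x (inj_eq enum_val_inj).
  have [<-|ij] := eqVneq i j; first by rewrite adj_irr mul0r subr0.
  rewrite mul0r sub0r; case: (adj _ _); last by rewrite !mul0r oppr0.
  rewrite mul1r mulNr; congr (- _).
  by rewrite natrM sqrtrM ?ler0n // invfM -/(q x) -/(q _) -mulrA mulKf.
rewrite (sum_enum_val (fun y => (x == y)%:R * (q y * g y)
  - (adj x y)%:R * ((q x)^-1 * g y))) sumrB; congr (_ - _).
  rewrite (bigD1 x) //= eqxx mul1r big1 ?addr0 // => y yx.
  by rewrite eq_sym (negbTE yx) mul0r.
rewrite mulr_sumr [RHS]big_mkcond /=; apply: eq_bigr => y _.
by case: adj; rewrite ?mul1r ?mul0r.
Qed.

(** The matrix [W = D^(1/2) Z D^(-1/2)] satisfies [L W = 1 - v^T v] for the unit kernel vector [v].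
    The trace of [(1 - v^T v) W] is the diagonal sum of [Z] minus the stationary mean of its row
    sums. *)
Lemma kemeny_green (Z : G -> G -> R) (x0 : G) : connected_graph G ->
  (forall x y, \sum_(z | adj x z) (Z x y - Z z y) =
     (degree x)%:R * ((x == y)%:R - (degree y)%:R / (\sum_(z : G) degree z)%:R)) ->
  kemeny R G = \sum_y (Z y y - Z x0 y).
Proof.
move=> Gconn ZE; set V := (\sum_(z : G) degree z)%:R in ZE.
have V_gt0 : 0 < V.
  by rewrite /V ltr0n (bigD1 x0) //= ltn_addr.
have degV : \sum_(z : G) (degree z)%:R = V by rewrite /V natr_sum.
have V_neq0 : V != 0 by rewrite gt_eqF.
(* Summed over [y], the defining equation of [Z] has right side 0: the row sums are harmonic. *)
have hZ x : \sum_y Z x y = \sum_y Z x0 y.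
  apply: (harmonic_constant (f := fun x => \sum_y Z x y)) => // {}x.
  under eq_bigr => z _ do rewrite -sumrB.
  rewrite exchange_big /=; under eq_bigr => y _ do rewrite ZE.
  rewrite -mulr_sumr sumrB -mulr_suml degV divff // (bigD1 x) //= eqxx.
  rewrite big1 ?addr0 ?subrr ?mulr0 // => y yx.
  by rewrite eq_sym (negbTE yx).
pose v : 'rV[R]_#|G| := \row_j (q (enum_val j) / Num.sqrt V).
pose W : 'M[R]_#|G| :=
  \matrix_(i, j) (q (enum_val i) * (Z (enum_val i) (enum_val j) / q (enum_val j))).
have Lsym : (normalized_laplacian R G)^T = normalized_laplacian R G.
  by apply/matrixP => i j; rewrite !mxE eq_sym /= adj_sym mulnC.
have vv i j : (v^T *m v) i j = q (enum_val i) * q (enum_val j) / V.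
  by rewrite mxE big_ord1 !mxE mulrACA -invfM -expr2 sqr_sqrtr ?ltW.
rewrite /kemeny (sum_inv_eigenvalues (Z := W) (v := v)) //.
- rewrite mulmxBl mul1mx raddfB /= sumrB; congr (_ - _).
    rewrite -sum_enum_val; apply: eq_bigr => i _.
    by rewrite mxE mulrCA divff ?mulr1.
  transitivity (\sum_x (degree x)%:R / V * \sum_y Z x y).
    under [RHS]eq_bigr => x _ do rewrite mulr_sumr.
    rewrite exchange_big /= -[RHS]sum_enum_val; apply: eq_bigr => i _.
    rewrite mxE -[RHS]sum_enum_val; apply: eq_bigr => j _.
    rewrite vv mxE -q_sqr; field.
    by rewrite V_neq0 q_neq0.
  under eq_bigr => x _ do rewrite hZ.
  by rewrite -mulr_suml -mulr_suml degV divff // mul1r.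
- move=> u; pose g x := u 0 (enum_rank x) / q x.
  rewrite (_ : _ 0 0 = \sum_x g x * \sum_(z | adj x z) (g x - g z)).
    exact: dirichlet_form_ge0.
  rewrite -mulmxA mxE -[RHS]sum_enum_val; apply: eq_bigr => i _.
  transitivity (u 0 i * ((q (enum_val i))^-1 *
    \sum_(z | adj (enum_val i) z) (g (enum_val i) - g z))); last first.
    by rewrite mulrA; congr (_ * _); rewrite /g enum_valK.
  congr (_ * _).
  rewrite -(normalized_laplacian_sum g) mxE; apply: eq_bigr => j _.
  by rewrite /g enum_valK [u^T _ _]mxE [q _ * _]mulrC divfK.
- apply: trmx_inj; rewrite trmx_mul Lsym trmx0; apply/colP => i.
  rewrite mxE (eq_bigr (fun j => normalized_laplacian R G i j
    * (q (enum_val j) * (Num.sqrt V)^-1))) => [|j _]; last by rewrite !mxE.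
  rewrite (normalized_laplacian_sum (fun=> (Num.sqrt V)^-1)).
  by rewrite big1 ?mulr0 ?mxE // => z _; rewrite subrr.
- apply/eqP => /rowP/(_ (enum_rank x0))/eqP; rewrite !mxE mulf_eq0 invr_eq0.
  by rewrite (negbTE (q_neq0 _)) sqrtr_eq0 leNgt V_gt0.
- apply/matrixP => i j; rewrite [RHS]mxE [X in _ = _ + X]mxE vv !mxE.
  under eq_bigr => k _ do rewrite [W _ _]mxE.
  rewrite (normalized_laplacian_sum (fun x => Z x (enum_val j) / q (enum_val j))).
  under eq_bigr => z _ do rewrite -mulrBl.
  rewrite -mulr_suml ZE (inj_eq enum_val_inj) -!q_sqr.
  have [->|ij] := eqVneq i j; rewrite ?(mulr1n, mulr0n); field;
    by rewrite ?q_neq0 ?V_neq0.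
Qed.
End Green.

(** * Neighbourhoods in the chains *)

(** The absolute difference, not the cyclic distance: wrapping is handled by a reflection rule for
    [f (N - d)]. *)
Definition dist (i l : nat) : nat := ((i - l) + (l - i))%N.

Lemma val_ordS N (i : 'I_N) : ordS i = (if i.+1 == N then 0 else i.+1)%N :> nat.
Proof.
have iN := ltn_ord i; rewrite /=; case: eqP => [->|/eqP iN']; first by rewrite modnn.
by rewrite modn_small // ltn_neqAle iN'.
Qed.

Lemma val_ord_pred N (i : 'I_N) :
  ord_pred i = (if i == 0 :> nat then N.-1 else i.-1)%N :> nat.
Proof.
have iN := ltn_ord i; rewrite /=; case: eqP => [->|/eqP i0].
  by rewrite add0n modn_small // prednK // (leq_ltn_trans _ iN).
have -> : ((i + N).-1 = i.-1 + N)%N by lia.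
by rewrite modnDr modn_small //; lia.
Qed.

Section CyclicStep.
Variables (R : comNzRingType) (N : nat) (eps : R) (f : nat -> R).
Hypothesis eps_sqr : eps * eps = 1.
Hypothesis f_rev : forall d, (d <= N)%N -> f (N - d)%N = eps * f d.

(** A step across the closing edge changes the distance to its complement in [N], and the factor
    [eps] undoes this. The twisted cyclic neighbours thus behave like the neighbours [i + 1] and
    [i - 1] on a line. *)
Lemma cyclic_step (i l : 'I_N) : (1 < N)%N ->
  (if i.+1 == N then eps else 1) * f (dist (ordS i) l) +
  (if i == 0 :> nat then eps else 1) * f (dist (ord_pred i) l) =
  if i == l then f 1%N + f 1%N else f (dist i l).+1 + f (dist i l).-1.
Proof.
move=> N_gt1; have iN := ltn_ord i; have lN := ltn_ord l.
have up : (if i.+1 == N then eps else 1) * f (dist (ordS i) l) = f (dist i.+1 l).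
  rewrite val_ordS; case: eqP => [->|_]; last by rewrite mul1r.
  have -> : dist N l = (N - dist 0 l)%N by rewrite /dist; lia.
  by rewrite f_rev // /dist; lia.
(* The distance from [i - 1] to [l] is written as that from [i] to [l + 1], which makes sense also
   for [i = 0]. *)
have down : (if i == 0 :> nat then eps else 1) * f (dist (ord_pred i) l) =
    f (dist i l.+1).
  rewrite val_ord_pred; case: eqP => [->|i0].
    have -> : dist N.-1 l = (N - dist 0 l.+1)%N by rewrite /dist; lia.
    rewrite f_rev; first by rewrite mulrA eps_sqr mul1r.
    by rewrite /dist; lia.
  by rewrite mul1r; congr f; rewrite /dist; lia.
rewrite up down; have [->|il] := eqVneq i l.
  by congr (f _ + f _); rewrite /dist; lia.
have {}il : (i != l :> nat) by [].
have [il'|il'] := ltnP i l.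
  by rewrite addrC; congr (f _ + f _); rewrite /dist; lia.
by congr (f _ + f _); rewrite /dist; lia.
Qed.
End CyclicStep.

Section Chain.
Variables (n : nat) (b : bool).
Definition chain_closing : rel (pent_vertex n) :=
  if b then @moebius_edge n else @cylinder_edge n.

Definition side (s : bool) (i : 'I_(2 * n)) : pent_vertex n :=
  if s then inl (inr i) else inl (inl i).

Lemma half_ord_subproof (i : 'I_(2 * n)) : (i./2 < n)%N.
Proof. by have := ltn_ord i; lia. Qed.
Definition half_ord i : 'I_n := Ordinal (half_ord_subproof i).

Lemma odd_ord_subproof (k : 'I_n) : ((2 * k).+1 < 2 * n)%N.
Proof. by have := ltn_ord k; lia. Qed.
Definition odd_ord k : 'I_(2 * n) := Ordinal (odd_ord_subproof k).

(** The third neighbour, beside the two along the cycle. With indices shifted by one, the odd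
    positions carry the [w_k]. *)
Definition rung (s : bool) (i : 'I_(2 * n)) : pent_vertex n :=
  if odd i then inr (half_ord i) else side (~~ s) i.

Lemma side_eqE s i t j : (side s i == side t j) = (s == t) && (i == j :> nat).
Proof. by case: s t => -[]. Qed.

Lemma side_inr s i k : (side s i == inr k) = false.
Proof. by case: s. Qed.

Lemma vertexP z : (exists t j, z = side t j) \/ (exists k, z = inr k).
Proof.
by case: z => [[j|j]|k]; [left; exists false | left; exists true | right]; eexists.
Qed.

Lemma adj_side_side s i t j : chain_adj chain_closing (side s i) (side t j) =
  (if s == t then (j == i.+1 :> nat) || (i == j.+1 :> nat)
   else (j == i :> nat) && ~~ odd i) ||
  (s (+) b == t) && ((i.+1 == 2 * n)%N && (j == 0 :> nat) ||
                (j.+1 == 2 * n)%N && (i == 0 :> nat)).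
Proof.
rewrite /chain_adj /chain_closing.
case: s; case: t; case: (b); rewrite /= ?orbF ?orbA // -?val_eqE /=.
1,2: by case: eqP => [/val_inj->|].
all: by rewrite eq_sym.
Qed.

(** Both chains are treated at once: a cyclic step changes side exactly when it wraps and [b]
    holds. *)
Lemma adj_side s i :
  chain_adj chain_closing (side s i) =1
  mem [:: side (s (+) (b && (i.+1 == 2 * n)%N)) (ordS i);
          side (s (+) (b && (i == 0 :> nat))) (ord_pred i); rung s i].
Proof.
have iN := ltn_ord i.
have := val_ordS i; have := val_ord_pred i.
move: (ordS i) (ord_pred i) => j1 j2 j2E j1E z.
have [[t [j ->]]|[k ->]] := vertexP z.
  have jN := ltn_ord j.
  rewrite adj_side_side /= !inE !side_eqE /rung.
  have -> : (side t j == (if odd i then inr (half_ord i) else side (~~ s) i)) =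
     [&& t != s, j == i :> nat & ~~ odd i].
    by case: odd; rewrite ?side_eqE ?andbF ?andbT ?eqb_negLR //; case: t; case: s.
  move: j1E j2E; case: eqP => ? ; case: eqP => ?; move=> -> ->;
    case: s; case: t; case: (b); rewrite /=; lia.
have -> : chain_adj chain_closing (side s i) (inr k) = (i == (2 * k).+1 :> nat).
  by rewrite /chain_adj /chain_closing; case: s; case: (b); rewrite /= ?orbF.
rewrite /= !inE /rung !(eq_sym (inr k)) !side_inr /=; case: (boolP (odd i)) => i_odd.
  by rewrite (_ : (_ == _) = (i./2 == k :> nat)) //; lia.
by rewrite side_inr; lia.
Qed.

Lemma adj_inr k :
  chain_adj chain_closing (inr k) =1
  mem [:: side false (odd_ord k); side true (odd_ord k)].
Proof.
move=> z; rewrite chain_adj_sym.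
rewrite -[RHS]/(z \in [:: side false (odd_ord k); side true (odd_ord k)]) !inE.
have [[t [j ->]]|[j ->]] := vertexP z; last first.
  by rewrite /chain_adj /chain_closing; case: (b).
rewrite !side_eqE /chain_adj /chain_closing; case: t; case: (b); by rewrite /= ?orbF.
Qed.

Hypothesis n_gt1 : (1 < n)%N.

Lemma sum_adj_side (V : nmodType) (F : pent_vertex n -> V) s i :
  \sum_(z | chain_adj chain_closing (side s i) z) F z =
  F (side (s (+) (b && (i.+1 == 2 * n)%N)) (ordS i)) +
  (F (side (s (+) (b && (i == 0 :> nat))) (ord_pred i)) + F (rung s i)).
Proof.
rewrite (eq_bigl _ _ (adj_side s i)) -big_uniq.
  by rewrite !big_cons big_nil /= addr0.
(* The three neighbours are distinct; the cycle has length at least 4, so successor and predecessor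
   differ. *)
rewrite /= !inE !negb_or /= andbT side_eqE val_ordS val_ord_pred.
have iN := ltn_ord i.
rewrite /rung; case: odd.
  rewrite !side_inr; have [h1|h1] := eqVneq i.+1 (2 * n)%N;
    have [h2|h2] := eqVneq (nat_of_ord i) 0%N;
    case: (s); case: (b); rewrite /=; lia.
rewrite !side_eqE val_ordS val_ord_pred; have [h1|h1] := eqVneq i.+1 (2 * n)%N;
  have [h2|h2] := eqVneq (nat_of_ord i) 0%N;
  case: (s); case: (b); rewrite /=; lia.
Qed.

Lemma sum_adj_inr (V : nmodType) (F : pent_vertex n -> V) k :
  \sum_(z | chain_adj chain_closing (inr k) z) F z =
  F (side false (odd_ord k)) + F (side true (odd_ord k)).
Proof.
by rewrite (eq_bigl _ _ (adj_inr k)) -big_uniq //= !big_cons big_nil /= addr0.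
Qed.

Lemma sum_vertex (V : nmodType) (F : pent_vertex n -> V) :
  \sum_z F z = \sum_i (F (side false i) + F (side true i)) + \sum_k F (inr k).
Proof. by rewrite big_sumType /= big_sumType /= big_split. Qed.
End Chain.

(** * The Green kernel of the chains *)

Section Kernel.
Variables (R : rcfType) (n : nat) (b : bool).
Hypothesis n_gt1 : (1 < n)%N.

Let N := (2 * n)%N.
Let a : R := Num.sqrt 3.
Let c : R := Num.sqrt 2.
(** The root below 1 of [X^2 - 2 * a * X + 1]; the other root is [a + c]. *)
Let t := a - c.
Let eps : R := (-1) ^+ b.

Let a_gt0 : 0 < a. Proof. by rewrite sqrtr_gt0. Qed.
Let c_gt0 : 0 < c. Proof. by rewrite sqrtr_gt0. Qed.
Let a_sqr : a * a = 3. Proof. by rewrite -expr2 sqr_sqrtr. Qed.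
Let c_sqr : c * c = 2. Proof. by rewrite -expr2 sqr_sqrtr. Qed.
Let n_neq0 : n%:R != 0 :> R. Proof. by rewrite pnatr_eq0; lia. Qed.

Let t_gt0 : 0 < t. Proof. by rewrite subr_gt0 ltr_sqrt // ltr_nat. Qed.
Let t_lt1 : t < 1.
Proof.
rewrite ltNge; apply/negP => t_ge1.
(* This product equals [a^2 - (c + 1)^2 = - 2 * c], which is negative. *)
have : 0 <= (t - 1) * (a + c + 1).
  by apply: mulr_ge0; [rewrite subr_ge0 | have := a_gt0; have := c_gt0; lra].
have := c_gt0; have := a_sqr; have := c_sqr; rewrite /t; lra.
Qed.

Let eps_sqr : eps * eps = 1. Proof. by rewrite -expr2 sqrr_sign. Qed.

Let eps_t_lt1 : 0 < 1 - eps * t ^+ N.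
Proof.
have tN : t ^+ N < 1 by rewrite exprn_ilt1 ?ltW // /N; lia.
have tN0 : 0 < t ^+ N by rewrite exprn_gt0.
by rewrite /eps; case: (b); rewrite ?expr0 ?expr1; lra.
Qed.

(** Up to a factor, the Green function of [2 * a - T] at distance [d] on the
    cycle of length [N], where [T] is the [eps]-periodic adjacency operator. *)
Definition decay d : R := t ^+ d + eps * t ^+ (N - d).

Lemma decay_rev d : (d <= N)%N -> decay (N - d) = eps * decay d.
Proof. by move=> dN; rewrite /decay subKn // mulrDr mulrA eps_sqr mul1r addrC. Qed.

Let t_char : 1 + t ^+ 2 = 2 * a * t.
Proof. by rewrite /t; ring: a_sqr c_sqr. Qed.

Let t_step m : t ^+ m.+2 + t ^+ m = 2 * a * t ^+ m.+1.
Proof. transitivity ((1 + t ^+ 2) * t ^+ m); first by rewrite !exprS; ring.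
by rewrite t_char exprS; ring. Qed.

Lemma decay_step d : (0 < d < N)%N -> decay d.+1 + decay d.-1 = 2 * a * decay d.
Proof.
case: d => [//|d] /= dN; rewrite /decay.
have [m Nm] : exists m, N = (d + m.+2)%N by exists (N - d - 2)%N; lia.
have -> : (N - d = m.+2)%N by lia.
have -> : (N - d.+1 = m.+1)%N by lia.
have -> : (N - d.+2 = m)%N by lia.
rewrite addrACA -mulrDr t_step [t ^+ m + _]addrC t_step; ring.
Qed.

(** The defect of the recurrence at the source, which fixes the normalization of [antisym_green]. It
    comes from [a - t = c] and [t - t^-1 = - 2 * c]. *)
Lemma decay_kink : 2 * a * decay 0 - (decay 1 + decay 1) = 2 * c * (1 - eps * t ^+ N).
Proof.
rewrite /decay subn0 expr0 expr1.
have [m ->] : exists m, N = m.+1 by exists N.-1; rewrite /N; lia.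
rewrite subn1 /= !exprS.
have -> : 2 * a * (1 + eps * (t * t ^+ m)) = 2 * a + eps * (2 * a * t) * t ^+ m by ring.
rewrite -t_char /t; move: (_ ^+ m) => T; ring: a_sqr c_sqr.
Qed.

Let w (i : nat) : R := if odd i then a else 2.
Let w_neq0 i : w i != 0.
Proof. by rewrite /w; case: odd; rewrite ?pnatr_eq0 // gt_eqF. Qed.

(** The potential alternates between [4] and [3]; conjugation by its square root
    [w] makes the operator translation invariant. *)
Definition antisym_green (i l : nat) : R :=
  6 * a / (2 * c * (1 - eps * t ^+ N)) * decay (dist i l) / (w i * w l).

(** The alternating term accounts for the larger stationary weight of the
    vertices carrying a [w_k]. *)
Definition sym_green (i l : nat) : R :=
  3 / (7 * n%:R) *
  (7 / 4 * ((dist i l)%:R ^+ 2 - N%:R * (dist i l)%:R) + (-1) ^+ odd i / 8).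

Let odd_ordS (i : 'I_N) : odd (ordS i) = ~~ odd i.
Proof. by rewrite val_ordS; case: eqP => // iN; rewrite -oddS iN oddM. Qed.

Let odd_ord_pred (i : 'I_N) : odd (ord_pred i) = ~~ odd i.
Proof.
rewrite val_ord_pred; have iN := ltn_ord i.
case: eqP => [->|]; last by case: (nat_of_ord i) => //= m; rewrite negbK.
by rewrite /N in iN *; lia.
Qed.

(** The degree is 3; at even positions the opposite vertex carries the negated value and raises the
    potential to 4, while at odd ones the function vanishes at the [w_k]. *)
Lemma antisym_green_eq (i l : 'I_N) :
  (if odd i then 3 else 4) * antisym_green i l
  - ((if i.+1 == N then eps else 1) * antisym_green (ordS i) l +
     (if i == 0 :> nat then eps else 1) * antisym_green (ord_pred i) l)
  = 3 *+ (i == l).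
Proof.
have N_gt1 : (1 < N)%N by rewrite /N; lia.
have := cyclic_step eps_sqr decay_rev i l N_gt1.
set K := 6 * a / (2 * c * (1 - eps * t ^+ N)).
rewrite /antisym_green -/K.
have -> : w (ordS i) = w i.+1 by rewrite /w odd_ordS.
have -> : w (ord_pred i) = w i.+1 by rewrite /w odd_ord_pred.
(* Consecutive weights have the same product for both parities, so the conjugated operator is
   [2 * a] minus the twisted adjacency. *)
have ww : w i * w i.+1 = 2 * a by rewrite /w /=; case: odd => /=; rewrite // mulrC.
have -> : (if odd i then 3 else 4) = w i * w i.
  by rewrite /w; case: odd => //; ring.
set e1 := if _ then _ else _; set e2 := if _ then _ else _.
set d1 := decay (dist _ _); set d2 := decay (dist (ord_pred i) l) => E.
transitivity (K / (w i.+1 * w l) * (2 * a * decay (dist i l) - (e1 * d1 + e2 * d2))).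
  by rewrite -ww; field; rewrite ?w_neq0.
rewrite E; have [<-|il] := eqVneq i l.
  have -> : dist i i = 0%N by rewrite /dist; lia.
  rewrite decay_kink mulr1n [_ * w i]mulrC ww /K.
  by field; rewrite !gt_eqF.
rewrite mulr0n decay_step ?subrr ?mulr0 //.
have := ltn_ord i; have := ltn_ord l; have : i != l :> nat by [].
by rewrite /dist; lia.
Qed.

(** Eliminating [w_k] moves one more unit of stationary mass to its position, whence 4 against 3.
    Over the cycle these weights add up to [7 * n], which balances the source. *)
Lemma sym_green_eq (i l : 'I_N) :
  2 * sym_green i l - (sym_green (ordS i) l + sym_green (ord_pred i) l)
  = 3 *+ (i == l) - 3 / (7 * n%:R) * (if odd i then 4 else 3).
Proof.
have N_gt1 : (1 < N)%N by rewrite /N; lia.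
pose f (d : nat) : R := d%:R ^+ 2 - N%:R * d%:R.
have f_rev d : (d <= N)%N -> f (N - d)%N = 1 * f d.
  by move=> dN; rewrite /f natrB //; ring.
have := cyclic_step (mulr1 1) f_rev i l N_gt1.
rewrite !if_same !mul1r /sym_green -!/(f _) odd_ordS odd_ord_pred => E.
(* The alternating sign is an eigenvector for the eigenvalue 4, turning [1 / 8] into [1 / 2]. Away
   from the source [f] has second difference 2, and [- 7 / 2] plus or minus [1 / 2] gives -3 or
   -4. *)
transitivity (3 / (7 * n%:R) * (7 / 4 * (2 * f (dist i l) -
    (f (dist (ordS i) l) + f (dist (ord_pred i) l))) + (-1) ^+ odd i / 2)).
  by rewrite signrN; field.
have NE : N%:R = 2 * n%:R :> R by rewrite natrM.
rewrite E; have [<-|il] := eqVneq i l.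
  have -> : dist i i = 0%N by rewrite /dist; lia.
  by rewrite mulr1n /f NE; case: odd; rewrite ?expr0 ?expr1; field.
have : (0 < dist i l)%N.
  by have : i != l :> nat by []; rewrite /dist; lia.
case: (dist i l) => [//|d] _; rewrite /= /f -natr1 -[d.+2%:R]natr1 -natr1 mulr0n.
by case: odd; rewrite ?expr0 ?expr1; field.
Qed.

Definition position (x : pent_vertex n) : 'I_N :=
  match x with inl (inl i) => i | inl (inr i) => i | inr k => odd_ord k end.

Definition side_sign (x : pent_vertex n) : R :=
  match x with inl (inl _) => 1 | inl (inr _) => -1 | inr _ => 0 end.

Definition is_rung (x : pent_vertex n) := if x is inr _ then true else false.

Definition stationary x : R := (if is_rung x then 2 else 3) / (14 * n%:R).

(** A source at a side vertex splits into symmetric and antisymmetric halves. A source at [w_k]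
    becomes, after elimination, a unit source at its position, one third of that of [sym_green]. The
    last term makes the value at [w_k] the mean of its neighbours plus its own source. *)
Definition chain_green (x y : pent_vertex n) : R :=
  sym_green (position x) (position y) / (if is_rung y then 3 else 2)
  + side_sign x * side_sign y / 2 * antisym_green (position x) (position y)
  + (if is_rung x then (x == y)%:R - stationary y else 0).

Lemma position_side s i : position (side s i) = i. Proof. by case: s. Qed.
Lemma side_sign_side s i : side_sign (side s i) = (-1) ^+ s. Proof. by case: s. Qed.
Lemma is_rung_side s i : is_rung (side s i) = false. Proof. by case: s. Qed.

Lemma position_rung s i : position (rung s i) = i.
Proof.
rewrite /rung; case: ifP => [i_odd|_]; last exact: position_side.
by apply: val_inj; rewrite /= -[RHS]odd_double_half i_odd mul2n.
Qed.

Lemma chain_green_inr k y : chain_green (inr k) y =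
  sym_green (odd_ord k) (position y) / (if is_rung y then 3 else 2)
  + ((inr k == y)%:R - stationary y).
Proof. by rewrite /chain_green /= !mul0r addr0. Qed.

Lemma chain_green_side s i y : chain_green (side s i) y =
  sym_green i (position y) / (if is_rung y then 3 else 2)
  + (-1) ^+ s * side_sign y / 2 * antisym_green i (position y).
Proof. by rewrite /chain_green position_side side_sign_side is_rung_side addr0. Qed.

Lemma chain_green_eq x y :
  \sum_(z | chain_adj (chain_closing b) x z) (chain_green x y - chain_green z y) =
  (if is_rung x then 2 else 3) * ((x == y)%:R - stationary y).
Proof.
have [[s [i ->]]|[k ->]] := vertexP x; last first.
  rewrite sum_adj_inr !chain_green_side chain_green_inr.
  by rewrite [is_rung (inr k)]/= expr0 expr1; ring.
(* On antisymmetric functions the change of side at the wrap becomes the factor [eps]. *)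
have sgn_wrap (m : bool) :
    (-1) ^+ (s (+) (b && m)) = (-1) ^+ s * (if m then eps else 1) :> R.
  by rewrite signr_addb /eps; case: m; rewrite ?andbT ?andbF.
rewrite sum_adj_side // is_rung_side !chain_green_side !sgn_wrap.
set l := position y.
have := sym_green_eq i l; have := antisym_green_eq i l.
set e1 := if _.+1 == _ then _ else _; set e2 := if _ == 0%N then _ else _.
move: (antisym_green (ordS i) l) (antisym_green (ord_pred i) l) => A1 A2.
move: (sym_green (ordS i) l) (sym_green (ord_pred i) l) => S1 S2.
have -> : chain_green (rung s i) y = sym_green i l / (if is_rung y then 3 else 2)
    + (if odd i then (rung s i == y)%:R - stationary y
       else - ((-1) ^+ s * side_sign y / 2 * antisym_green i l)).
  rewrite /chain_green position_rung -/l; rewrite /rung; case: odd => /=.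
    by rewrite !mul0r addr0.
  by rewrite is_rung_side side_sign_side addr0; case: (s); rewrite ?expr0 ?expr1; ring.
move: (antisym_green i l) (sym_green i l) => A S.
pose D : R := if odd i then 3 else 4; pose D' : R := if odd i then 4 else 3.
pose q : R := if is_rung y then 3 else 2.
pose r : R := (rung s i == y)%:R - stationary y.
rewrite -/D -/D' -/q -/r; clearbody e1 e2 => EA ES.
transitivity ((3 *+ (i == l) - 3 / (7 * n%:R) * D') / q
   + (-1) ^+ s * side_sign y / 2 * (3 *+ (i == l)) - (if odd i then r else 0)).
  rewrite -ES -EA /D.
  by case: odd; move: (_ ^+ s) (side_sign y) (q^-1) => *; field.
rewrite /D' /q /r /stationary /l; have [[u [j ->]]|[k ->]] := vertexP y.
  rewrite is_rung_side side_sign_side position_side side_eqE -val_eqE /=.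
  have -> : (if odd i then (rung s i == side u j)%:R - 3 / (14 * n%:R) else 0) =
      (if odd i then - (3 / (14 * n%:R)) else 0) :> R.
    by rewrite /rung; case: odd; rewrite // eq_sym side_inr sub0r.
  case: (i == j :> nat); case: odd; case: (s); case: (u);
    by rewrite ?(expr0, expr1, mulr0n, mulr1n) /=; field.
rewrite side_inr mulr0 mul0r mul0r /=.
have [->|ij] := eqVneq i (odd_ord k).
  have odd_k : odd (odd_ord k) by rewrite /= oddM.
  have -> : rung s (odd_ord k) == inr k.
    by rewrite /rung odd_k; apply/eqP; congr inr; apply: val_inj => /=; lia.
  by rewrite odd_k /= !mulr1n; field.
have -> : (rung s i == inr k) = false.
  by apply: contraNF ij => /eqP r_k; rewrite -(position_rung s i) r_k.
by case: odd; rewrite !mulr0n; field.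
Qed.

(** * Evaluation of Kemeny's constant *)

Section Kemeny.
Hypothesis irr : irreflexive (chain_adj (@chain_closing n b)).
Let G := SGraph (chain_adj_sym (@chain_closing n b)) irr.

Lemma chain_degree (x : G) : degree x = if is_rung x then 2%N else 3%N.
Proof.
rewrite /degree -sum1_card; under eq_bigl => z do rewrite inE.
have [[s [i ->]]|[k ->]] := vertexP x.
  by rewrite (sum_adj_side _ n_gt1 (fun=> 1%N)) is_rung_side.
by rewrite (sum_adj_inr _ (fun=> 1%N)).
Qed.

Lemma sum_chain_degree : (\sum_(x : G) degree x = 14 * n)%N.
Proof.
under eq_bigr => x _ do rewrite chain_degree.
rewrite sum_vertex /= !sum_nat_const !card_ord; lia.
Qed.

Lemma sum_double (F : nat -> R) m :
  \sum_(i < 2 * m) F i = \sum_(k < m) (F (2 * k)%N + F (2 * k).+1).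
Proof.
elim: m => [|m IHm]; first by rewrite muln0 !big_ord0.
by rewrite mulnS !big_ord_recr /= IHm addrA.
Qed.

Lemma sum_quadratic (x0 x1 x2 : R) m :
  \sum_(k < m) (x0 + x1 * k%:R + x2 * k%:R ^+ 2) =
  x0 * m%:R + x1 * (m%:R * (m%:R - 1) / 2)
  + x2 * (m%:R * (m%:R - 1) * (2 * m%:R - 1) / 6).
Proof.
elim: m => [|m IHm]; first by rewrite big_ord0; ring.
by rewrite big_ord_recr /= IHm -natr1; field.
Qed.

Lemma kemeny_chain : kemeny R G =
    (49 * n%:R ^+ 2 + 42 * n%:R - 19) / 42
    + (7 * Num.sqrt 6 * n%:R / 8 * ((a + c) ^+ N - t ^+ N))
      / ((a + c) ^+ N + t ^+ N - 2 * eps).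
Proof.
have N_gt0 : (0 < N)%N by rewrite /N; lia.
pose o : 'I_N := Ordinal N_gt0.
have -> : kemeny R G = \sum_y (chain_green y y - chain_green (side false o) y).
  apply: (@kemeny_green R G _ chain_green (side false o)) => [x|x y|x y].
  - by rewrite chain_degree; case: ifP.
  - exact: chain_connected.
  rewrite sum_chain_degree !chain_degree chain_green_eq natrM /stationary.
  by case: is_rung; case: is_rung.
pose q (l : nat) := sym_green l l - sym_green 0 l.
rewrite sum_vertex.
(* The antisymmetric values at the base vertex have opposite signs for [u_i] and [u'_i] and
   cancel. *)
rewrite (eq_bigr (fun i : 'I_N => q i + antisym_green i i)); last first.
  move=> i _; rewrite !chain_green_side !is_rung_side !position_side !side_sign_side.
  by rewrite /q !(expr0, expr1); field.
rewrite (sum_double (fun i => q i + antisym_green i i)).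
rewrite [X in _ + X](eq_bigr (fun k : 'I_n =>
    q (2 * k).+1 / 3 + 1 - (7 * n%:R)^-1)); last first.
  move=> k _; rewrite chain_green_side chain_green_inr /= eqxx mulr0 mul0r mul0r.
  by rewrite /q /stationary /=; field.
rewrite -big_split /=.
pose L := 6 * a / (2 * c * (1 - eps * t ^+ N)) * decay 0.
have dist0 l : dist 0 l = l by rewrite /dist; lia.
have distl l : dist l l = 0%N by rewrite /dist; lia.
have NE : N%:R = 2 * n%:R :> R by rewrite natrM.
(* Here [7 / 12] is [1 / 4 + 1 / 3], from the squared weights 4 and 3 at the two positions of index
   [k]. *)
rewrite (eq_bigr (fun k : 'I_n => (3 - 9 / (7 * n%:R) + 7 / 12 * L)
   + (7 - 4 / n%:R) * k%:R + (- 7 / n%:R) * k%:R ^+ 2)); last first.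
  move=> k _; rewrite /q /sym_green /antisym_green !dist0 !distl -/L.
  have odd0 : odd (2 * k) = false by rewrite oddM.
  have odd1 : odd (2 * k).+1 by rewrite /= odd0.
  rewrite /w odd0 odd1 NE -[(2 * k).+1%:R]natr1 !natrM !(expr0, expr1) a_sqr.
  by move: L => L; field.
rewrite sum_quadratic.
have -> : L = 3 * a * c / 2 * ((1 + eps * t ^+ N) / (1 - eps * t ^+ N)).
  by rewrite /L /decay subn0 expr0 -[in RHS]c_sqr; field; rewrite !gt_eqF.
have -> : Num.sqrt 6 = a * c.
  by rewrite -sqrtrM // -natrM.
have -> : (a + c) ^+ N = (t ^+ N)^-1.
  apply: (mulIf (x := t ^+ N)); first by rewrite expf_neq0 ?gt_eqF.
  rewrite mulVf ?expf_neq0 ?gt_eqF // -exprMn (_ : _ * t = 1) ?expr1n //.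
  by rewrite /t; ring: a_sqr c_sqr.
have tN_neq0 : t ^+ N != 0 by rewrite expf_neq0 ?gt_eqF.
have : 1 - eps * t ^+ N != 0 by rewrite gt_eqF.
move: (t ^+ N) eps eps_sqr tN_neq0 => T e e_sqr T_neq0 eT_neq0.
(* Inserting [e * e = 1] exposes the common factor [1 - e * T] of numerator and denominator. *)
have -> : T^-1 - T = (1 - e * e * T * T) / T by rewrite e_sqr; field.
have -> : T^-1 + T - 2 * e = (1 + e * e * T * T - 2 * e * T) / T.
  by rewrite e_sqr; field.
have -> : 1 - e * e * T * T = (1 - e * T) * (1 + e * T) by ring.
have -> : 1 + e * e * T * T - 2 * e * T = (1 - e * T) * (1 - e * T) by ring.
by field; rewrite n_neq0 T_neq0 eT_neq0.
Qed.
End Kemeny.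
End Kernel.

Theorem theorem7 (R : rcfType) (n : nat) (hn : (2 <= n)%N) :
  kemeny R (pentagonal_cylinder_chain n) =
    (49 * n%:R ^+ 2 + 42 * n%:R - 19) / 42
    + (7 * Num.sqrt 6 * n%:R / 8
       * ((Num.sqrt 3 + Num.sqrt 2) ^+ (2 * n)
          - (Num.sqrt 3 - Num.sqrt 2) ^+ (2 * n)))
      / ((Num.sqrt 3 + Num.sqrt 2) ^+ (2 * n)
         + (Num.sqrt 3 - Num.sqrt 2) ^+ (2 * n) - 2)
  /\
  kemeny R (pentagonal_moebius_chain n) =
    (49 * n%:R ^+ 2 + 42 * n%:R - 19) / 42
    + (7 * Num.sqrt 6 * n%:R / 8
       * ((Num.sqrt 3 + Num.sqrt 2) ^+ (2 * n)
          - (Num.sqrt 3 - Num.sqrt 2) ^+ (2 * n)))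
      / ((Num.sqrt 3 + Num.sqrt 2) ^+ (2 * n)
         + (Num.sqrt 3 - Num.sqrt 2) ^+ (2 * n) + 2).
Proof.
split.
  have := kemeny_chain R (b := false) hn (@cylinder_adj_irr n).
  by rewrite expr0 mulr1.
have := kemeny_chain R (b := true) hn (@moebius_adj_irr n).
by rewrite expr1 mulrN1 opprK.
Qed.
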